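(* Consider the Global Flux (GF) Galerkin semi-discretization $$ \begin{cases} M_x\otimes M_y\,\partial_t \mathrm u + D_x\otimes M_y\,\bigl(\mathrm p-I_x\otimes\mathbf 1_y\,\mathrm S_u\bigr)=0,\\ M_x\otimes M_y\,\partial_t \mathrm v + M_x\otimes D_y\,\bigl(\mathrm p-\mathbf 1_x\otimes I_y\,\mathrm S_v\bigr)=0,\\ M_x\otimes M_y\,\partial_t \mathrm p + D_x\otimes D_y\,\bigl(\mathbf 1_x\otimes I_y\,\mathrm u+I_x\otimes \mathbf 1_y\,\mathrm v-I_x\otimes I_y\,\mathrm S_p\bigr)=0 \end{cases} $$ (notation as in the context). For each cell $E=E_{ij}$ and $s,t\in\{0,\dots,K\}$ let $\Phi^E_{i,s;j,t}=\bigl([\Phi^E_u]_{i,s;j,t},[\Phi^E_v]_{i,s;j,t},[\Phi^E_p]_{i,s;j,t}\bigr)$ be the sub-cell integrated residuals $$ \begin{aligned} [\Phi^E_u]_{i,s;j,t}&=\int_{x_{i,0}}^{x_{i,s}}\bigl(\partial_xp_h-(S_u)_h\bigr)(x,y_{j,t})\,dx,\\ [\Phi^E_v]_{i,s;j,t}&=\int_{y_{j,0}}^{y_{j,t}}\bigl(\partial_yp_h-(S_v)_h\bigr)(x_{i,s},y)\,dy,\\ [\Phi^E_p]_{i,s;j,t}&=\int_{x_{i,0}}^{x_{i,s}}\int_{y_{j,0}}^{y_{j,t}}\bigl(\partial_xu_h+\partial_yv_h-(S_p)_h\bigr)\,dy\,dx . \end{aligned} $$ The scheme admits the discrete steady states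 characterized by the condition $$ \Phi^{E}_{i,s;j,t}=0\qquad\text{for all } s,t\in\{0,\dots,K\}\text{ and all cells }E=E_{ij}. $$ That is, whenever $(u_h,v_h,p_h)$ satisfies this condition, the spatial (time-derivative-free) part of each of the three equations vanishes.
   Context: PDE. The scheme approximates $\partial_t u+\partial_x p=S_u$, $\partial_t v+\partial_y p=S_v$, $\partial_t p+\partial_x u+\partial_y v=S_p$ on a rectangle $\Omega=[x_0,x_e]\times[y_0,y_e]$. The velocity source is $(S_u,S_v)=c(x,y)(v,-u)-f(x,y)(u,v)+\boldsymbol\tau(x,y)$ with given functions $c,f,\boldsymbol\tau$, and $S_p$ is a scalar source. Mesh and spaces. $\Omega$ is divided into uniform Cartesian cells $E_{ij}=[x_i,x_{i+1}]\times[y_j,y_{j+1}]$, $0\le i<N_x$, $0\le j<N_y$. Fix a degree $K\ge 1$. Each cell $[x_i,x_{i+1}]$ carries the $K+1$ Gauss-Lobatto points $x_{i,0}=x_i<\dots<x_{i,K}=x_{i+1}$ (so the nodes $(i,0)$ and $(i-1,K)$ are identified), and similarly $y_{j,0},\dots,y_{j,K}$. Let $\varphi^x_\alpha$ be the continuous piecewise-$\mathbb P^K$ Lagrange basis at the 1D nodes $\alpha=(i,p)$ in $x$, and $\varphi^y_\beta$ the one in $y$. $V_h$ is the space spanned by the products $\varphi^x_\alpha(x)\varphi^y_\beta(y)$. A function $q_h\in V_h$ is identified with its array $\mathrm q=(\mathrm q_{\alpha;\beta})$ of nodal values, and $(A\otimes B)\mathrm q$ has entries $\sum_{\alpha',\beta'}A_{\alpha\alpha'}B_{\beta\beta'}\mathrm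 q_{\alpha';\beta'}$. Matrices. $(M_x)_{\alpha\beta}=\int\varphi^x_\alpha\varphi^x_\beta\,dx$ and $(D_x)_{\alpha\beta}=\int\varphi^x_\alpha\,(\varphi^x_\beta)'\,dx$, with integrals computed by Gauss-Lobatto quadrature at the nodes (so the mass matrix $M_x$ is diagonal); $M_y,D_y$ are defined analogously in $y$. $\mathbf 1_x,\mathbf 1_y$ are identity matrices. Integration operators. For a 1D nodal array $\mathrm q$ with interpolant $q_h$, $(I_x\mathrm q)_{i,p}=(I_x\mathrm q)_{i,0}+\int_{x_{i,0}}^{x_{i,p}}q_h(x)\,dx$, with continuity $(I_x\mathrm q)_{i,0}=(I_x\mathrm q)_{i-1,K}$ across cells and initial value $0$ at $x_0$; $I_y$ is analogous. Sources and boundary. $\mathrm S_u,\mathrm S_v,\mathrm S_p$ are the arrays of nodal values of the sources (evaluated at the nodal unknowns where they depend on them), and $(S_u)_h,(S_v)_h,(S_p)_h\in V_h$ the corresponding interpolants. The variational equations are tested with functions of $V_h$ vanishing on $\partial\Omega$ and are complemented by boundary conditions. A discrete steady state is a state for which the spatial part of the equations vanishes. *)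

(* Defs.v *)
From HB Require Import structures.
From mathcomp Require Import all_boot all_order all_algebra polyrcf ring.
From mathcomp Require polyorder.
From mathcomp Require Import all_classical all_reals all_analysis.
Set Implicit Arguments.
Unset Strict Implicit.
Unset Printing Implicit Defensive.
Import Order.TTheory GRing.Theory Num.Theory.
Import numFieldNormedType.Exports.
Local Open Scope classical_set_scope.
Local Open Scope ring_scope.

(* Rodrigues' formula. *)
Definition legendre (R : fieldType) (K : nat) : {poly R} :=
  (2 ^+ K * K`!%:R)^-1 *: (('X^2 - 1) ^+ K)^`(K).

(* The K+1 Gauss-Lobatto points of [-1, 1]: both end points and the K-1 zeros
   of P_K'.  For K >= 1 exactly one family satisfies this, see
   gauss_lobatto_exists and gauss_lobatto_unique. *)
Definition gauss_lobatto (R : realType) (K : nat) (xi : 'I_K.+1 -> R) : Prop :=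
  [/\ xi ord0 = -1, xi ord_max = 1,
      {homo xi : p q / (p < q)%N >-> p < q}
    & forall p, p != ord0 -> p != ord_max -> root (deriv (legendre R K)) (xi p)].

Lemma size_legendre (R : realType) (K : nat) : size (legendre R K) = K.+1.
Proof.
rewrite /legendre size_scale; last first.
  by rewrite invr_eq0 mulf_neq0 ?expf_neq0 ?pnatr_eq0 -?lt0n ?fact_gt0.
have szf : size (('X^2 - 1 : {poly R}) ^+ K) = (K.*2).+1.
  have X0 : ('X^2 - 1 : {poly R}) != 0.
    by rewrite -size_poly_gt0 -polyC1 size_XnsubC.
  have := size_exp ('X^2 - 1 : {poly R}) K.
  rewrite -{2}polyC1 size_XnsubC // mul2n => <-.
  by rewrite prednK // size_poly_gt0 expf_neq0.
suff H j : size (('X^2 - 1 : {poly R}) ^+ K)^`(j) = ((K.*2).+1 - j)%N.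
  by rewrite H -addnn subSn ?leq_addr // addnK.
elim: j => [|j IH]; first by rewrite derivn0 szf subn0.
by rewrite derivnS polyorder.size_deriv IH subnS.
Qed.

Lemma rolle_seq (R : realType) (g : {poly R}) (s : seq R) (x : R) :
    path <%R x s -> all (root g) (x :: s) ->
  exists t : seq R, [/\ size t = size s, path <%R x t,
    all (< last x s) t & all (root (deriv g)) t].
Proof.
elim: s x => [|y s IH] x /=; first by exists [::].
move=> /andP[xy ps] /and3P[gx gy gs].
have [|t [szt pt at_ rt]] := IH y ps; first by rewrite /= gy.
have [c cxy gc] := poly_rolle xy (etrans (rootP gx) (esym (rootP gy))).
move: cxy; rewrite in_itv /= => /andP[xc cy].
exists (c :: t); split => /=; rewrite ?szt //.
- by rewrite xc /= (path_le lt_trans cy pt).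
- rewrite at_ andbT (lt_le_trans cy) //.
  by have := order_path_min lt_trans ps; case: (lastP s) => //= s' z;
    rewrite last_rcons all_rcons => /andP[/ltW].
- by rewrite rt andbT; apply/rootP.
Qed.

Lemma gauss_lobatto_exists (R : realType) (K : nat) :
  (1 <= K)%N -> exists xi : 'I_K.+1 -> R, gauss_lobatto xi.
Proof.
move=> K0; set q : {poly R} := 'X^2 - 1.
have q1 (e : R) : e ^+ 2 = 1 -> root q e.
  by move=> he; rewrite /root !hornerE he subrr.
have dvd j : (j <= K)%N -> exists r, (q ^+ K)^`(j) = q ^+ (K - j) * r.
  elim: j => [_|j IH jK]; first by exists 1; rewrite subn0 mulr1 derivn0.
  have [r Hr] := IH (ltnW jK).
  rewrite derivnS Hr derivM deriv_exp -(subnSK jK) /=.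
  exists ((deriv q *+ (K - j.+1).+1) * r + q * deriv r).
  by rewrite exprS; ring.
have seqs j : (j <= K)%N -> exists s : seq R, [/\ size s = j,
    path <%R (-1) s, all (< 1) s & all (root (q ^+ K)^`(j)) s].
  elim: j => [_|j IH jK]; first by exists [::].
  have [s [szs ps als rs]] := IH (ltnW jK).
  have [r Hr] := dvd j (ltnW jK).
  have re (e : R) : e ^+ 2 = 1 -> root (q ^+ K)^`(j) e.
    move=> he; rewrite Hr rootM; apply/orP; left.
    by rewrite -(subnSK jK) exprS rootM q1.
  have [||t [szt pt at_ rt]] := @rolle_seq R ((q ^+ K)^`(j)) (rcons s 1) (-1).
  - rewrite rcons_path ps /=; case: (lastP s) als => [_|s' z] /=.
      by rewrite (@lt_trans _ _ 0) ?ltrN10 ?ltr01.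
    by rewrite last_rcons all_rcons => /andP[].
  - by rewrite /= re ?sqrrN ?expr1n // all_rcons re ?expr1n.
  by exists t; rewrite szt size_rcons szs -derivnS in rt *; rewrite last_rcons in at_.
have [s [szs ps als rs]] := seqs K (leqnn K).
case: s szs ps als rs => [|x s] /=; first by move=> E; rewrite -E in K0.
move=> szs /andP[x1 ps] /andP[xlt als] rs.
have [t [szt pt at_ rt]] := rolle_seq ps rs.
have st : sorted <%R (-1 :: rcons t 1).
  rewrite /= rcons_path (path_le lt_trans x1 pt) /=.
  have l1 : last x s < 1.
    by case: (lastP s) als => //= s' z; rewrite last_rcons all_rcons => /andP[].
  case: (lastP t) at_ => [_|t' z] /=.
    by rewrite (@lt_trans _ _ 0) ?ltrN10 ?ltr01.
  by rewrite last_rcons all_rcons => /andP[/lt_trans + _]; apply.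
have szr : size (-1 :: rcons t 1) = K.+1 by rewrite /= size_rcons szt szs.
exists (fun p => nth 0 (-1 :: rcons t 1) p); split => //.
- by rewrite -[LHS]/(nth 0 (-1 :: rcons t 1) K) -szs -szt /= nth_rcons ltnn eqxx.
- by move=> p1 p2 lt12; rewrite lt_sorted_ltn_nth // inE szr.
move=> [[|k] Hk] //= _; rewrite -val_eqE /= => kK.
rewrite nth_rcons.
have kt : (k < size t)%N by rewrite szt -ltnS szs ltn_neqAle kK -ltnS.
rewrite kt /legendre linearZ /= rootZ -?derivnS; last first.
  by rewrite invr_eq0 mulf_neq0 ?expf_neq0 ?pnatr_eq0 -?lt0n ?fact_gt0.
by have /allP := rt; apply; rewrite mem_nth.
Qed.

Lemma gauss_lobatto_unique (R : realType) (K : nat) (xi xi' : 'I_K.+1 -> R) :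
  (1 <= K)%N -> gauss_lobatto xi -> gauss_lobatto xi' -> xi =1 xi'.
Proof.
move=> K0.
set Q : {poly R} := ('X^2 - 1) * deriv (legendre R K).
have L0 : deriv (legendre R K) != 0.
  by rewrite -size_poly_gt0 polyorder.size_deriv size_legendre.
have X0 : ('X^2 - 1 : {poly R}) != 0.
  by rewrite -size_poly_gt0 -polyC1 size_XnsubC.
have Q0 : Q != 0 by rewrite mulf_neq0.
have szQ : size Q = K.+2.
  rewrite size_mul // -polyC1 size_XnsubC // polyorder.size_deriv.
  by rewrite size_legendre.
pose tab (z : 'I_K.+1 -> R) := [seq z p | p <- enum 'I_K.+1].
have srt z : gauss_lobatto z -> sorted <%R (tab z).
  case=> _ _ hz _; rewrite /tab sorted_map.
  have := iota_ltn_sorted 0 K.+1; rewrite -val_enum_ord sorted_map.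
  by apply: sub_sorted => p1 p2; apply: hz.
have rtz z : gauss_lobatto z -> all (root Q) (tab z).
  case=> z0 z1 _ hz; apply/allP => _ /mapP[p _ ->]; rewrite /Q rootM.
  have [->|p0] := eqVneq p ord0.
    by rewrite z0 /root !hornerE sqrrN expr1n subrr eqxx.
  have [->|p1] := eqVneq p ord_max.
    by rewrite z1 /root !hornerE expr1n subrr eqxx.
  by rewrite hz ?orbT.
have sub z z' : gauss_lobatto z -> gauss_lobatto z' ->
    {subset tab z <= tab z'}.
  move=> hz hz' y yz; apply: contraT => yz'.
  have := @max_poly_roots _ Q (y :: tab z') Q0.
  rewrite /= (allP (rtz _ hz)) // rtz // yz' (lt_sorted_uniq (srt _ hz')).
  by rewrite szQ size_map size_enum_ord ltnn => /(_ isT isT).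
move=> h h' p.
have E : tab xi = tab xi'.
  by apply: lt_sorted_eq; rewrite ?srt // => y; apply/idP/idP; apply: sub.
have := congr1 (fun s => nth 0 s p) E.
have nt z : nth 0 (tab z) p = z p.
  rewrite (nth_map ord0) ?size_enum_ord //; congr (z _); exact: nth_ord_enum.
by rewrite !nt.
Qed.

Section Grid1D.
Variables (R : realType) (K : nat) (xi : 'I_K.+1 -> R).
(* [a, b] is divided into N uniform cells. *)
Variables (N : nat) (a b : R).

Definition mesh_size : R := (b - a) / N%:R.

Definition cell_left (i : nat) : R := a + i%:R * mesh_size.

(* The point x_{i,p}. *)
Definition gl_node (i : nat) (p : 'I_K.+1) : R :=
  cell_left i + mesh_size * ((1 + xi p) / 2).

(* The unknowns of a 1D array are numbered by 'I_(N * K).+1, the pair (i, p)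
   having number i * K + p; this identifies (i, 0) with (i - 1, K). *)
Definition dof (i : 'I_N) (p : 'I_K.+1) : 'I_(N * K).+1 := inord (i * K + p).

(* Conversely an unknown is read as the pair (al %/ K, al %% K); the last one,
   al = N * K, is then the left point of a fictitious cell number N. *)
Definition dof_cell (al : 'I_(N * K).+1) : nat := (al %/ K)%N.
Definition dof_pos (al : 'I_(N * K).+1) : 'I_K.+1 := inord (al %% K).
Definition dof_coord (al : 'I_(N * K).+1) : R :=
  gl_node (dof_cell al) (dof_pos al).

(* Lagrange polynomials of the cell i. *)
Definition cell_lagrange (i : nat) (p : 'I_K.+1) : {poly R} :=
  \prod_(q < K.+1 | q != p)
     ((gl_node i p - gl_node i q)^-1 *: ('X - (gl_node i q)%:P)).

(* The polynomial that phi_al coincides with on the cell i. *)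
Definition nodal_basis_on (i : 'I_N) (al : 'I_(N * K).+1) : {poly R} :=
  \sum_(p < K.+1 | dof i p == al) cell_lagrange i p.

(* The global function phi_al.  At an interface the polynomials of the two
   adjacent cells agree (cf. nodal_basis_node), so the choice made there is
   irrelevant. *)
Definition nodal_basis (al : 'I_(N * K).+1) (x : R) : R :=
  if [pick i : 'I_N | cell_left i <= x <= cell_left i.+1] is Some i
  then (nodal_basis_on i al).[x] else 0.

Definition quad_weight (i : nat) (p : 'I_K.+1) : R :=
  \int[lebesgue_measure]_(x in `[cell_left i, cell_left i.+1])
     (cell_lagrange i p).[x].

Definition mass_mx : 'M[R]_((N * K).+1) := \matrix_(al, be)
  \sum_(i < N) \sum_(p < K.+1) quad_weight i p *
    ((nodal_basis_on i al).[gl_node i p] * (nodal_basis_on i be).[gl_node i p]).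

(* At an interface phi_be' has two one-sided values; each cell contributes to
   the quadrature with its own. *)
Definition deriv_mx : 'M[R]_((N * K).+1) := \matrix_(al, be)
  \sum_(i < N) \sum_(p < K.+1) quad_weight i p *
    ((nodal_basis_on i al).[gl_node i p] * (deriv (nodal_basis_on i be)).[gl_node i p]).

Definition interp1 (q : 'cV[R]_((N * K).+1)) (x : R) : R :=
  \sum_al q al 0 * nodal_basis al x.

Definition int_from_left (q : 'cV[R]_((N * K).+1)) (i : nat) (p : 'I_K.+1) : R :=
  \int[lebesgue_measure]_(x in `[gl_node i ord0, gl_node i p]) interp1 q x.

Fixpoint int_start (q : 'cV[R]_((N * K).+1)) (i : nat) : R :=
  if i is j.+1 then int_start q j + int_from_left q j ord_max else 0.

Definition int_op (q : 'cV[R]_((N * K).+1)) : 'cV[R]_((N * K).+1) :=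
  \col_al (int_start q (dof_cell al) + int_from_left q (dof_cell al) (dof_pos al)).

(* The matrix of the linear operator int_op. *)
Definition int_mx : 'M[R]_((N * K).+1) :=
  \matrix_(al, be) int_op (delta_mx be 0) al 0.

End Grid1D.

Section Grid1DTheory.
Variables (R : realType) (K : nat) (xi : 'I_K.+1 -> R).
Variables (N : nat) (a b : R).

Lemma dofK (i : 'I_N) (p : 'I_K.+1) : dof i p = (i * K + p)%N :> nat.
Proof.
rewrite /dof inordK // ltnS (@leq_trans (i.+1 * K)) //.
  by rewrite mulSn addnC leq_add2r -ltnS.
by rewrite leq_mul2r ltn_ord orbT.
Qed.

(* The defining relations of I_x; the continuity across cells is dof (i, 0) =
   dof (i - 1, K). *)
Lemma int_op_spec (q : 'cV[R]_((N * K).+1)) : (1 <= K)%N ->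
  (forall i : 'I_N, val i = 0%N -> int_op xi a b q (dof i ord0) 0 = 0) /\
  (forall (i : 'I_N) (p : 'I_K.+1), int_op xi a b q (dof i p) 0 =
     int_op xi a b q (dof i ord0) 0 + int_from_left xi a b q i p).
Proof.
move=> K0.
have refl0 i : int_from_left xi a b q i ord0 = 0.
  by rewrite /int_from_left set_itv1 Rintegral_set1.
have left_ (i : 'I_N) : int_op xi a b q (dof i ord0) 0 = int_start xi a b q i.
  rewrite mxE /dof_cell /dof_pos dofK addn0 mulnK // modnMl.
  by rewrite (_ : inord 0 = ord0) ?refl0 ?addr0 //; apply/val_inj; rewrite /= inordK.
split=> [i i0|i p]; first by rewrite left_ i0.
rewrite left_ mxE /dof_cell /dof_pos dofK.
have [pK|Kp] := ltnP p K.
  by rewrite divnMDl // divn_small // addn0 modnMDl modn_small // inord_val.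
have {Kp} -> : p = ord_max.
  by apply/val_inj/eqP; rewrite /= eqn_leq Kp -ltnS ltn_ord.
rewrite /= -mulSnr mulnK // modnMl (_ : inord 0 = ord0); last first.
  by apply/val_inj; rewrite /= inordK.
by rewrite refl0 addr0.
Qed.

Lemma nodal_basis_node (al : 'I_(N * K).+1) (i : 'I_N) (p : 'I_K.+1) :
  (1 <= K)%N -> gauss_lobatto xi -> a < b ->
  nodal_basis xi a b al (gl_node xi N a b i p) = (dof i p == al)%:R.
Proof.
move=> K0 [xi0 xi1 xilt _] ab.
have N0 : (0 < N)%N by apply: leq_trans (ltn_ord i).
have h0 : 0 < mesh_size N a b by rewrite divr_gt0 ?subr_gt0 ?ltr0n.
have xi_le (q q' : 'I_K.+1) : (q <= q')%N -> xi q <= xi q'.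
  by rewrite leq_eqVlt => /orP[/eqP/val_inj->//|/xilt/ltW].
have node0 j : gl_node xi N a b j ord0 = cell_left N a b j.
  by rewrite /gl_node xi0 subrr mul0r mulr0 addr0.
have node1 j : gl_node xi N a b j ord_max = cell_left N a b j.+1.
  rewrite /gl_node xi1 /cell_left -addrA; congr (_ + _).
  by rewrite divff ?pnatr_eq0 // mulr1 -natr1 mulrDl mul1r.
have node_lt j (q q' : 'I_K.+1) : (q < q')%N -> gl_node xi N a b j q < gl_node xi N a b j q'.
  by move=> /xilt lt_; rewrite ltrD2l ltr_pM2l // ltr_pM2r ?invr_gt0 // ltrD2l.
have node_inj j : injective (gl_node xi N a b j).
  move=> q q' E; apply/val_inj/eqP; case: ltngtP => // /(node_lt j);
  by rewrite E ltxx.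
have node_le0 j q : cell_left N a b j <= gl_node xi N a b j q.
  rewrite -node0; have [->//|q0] := eqVneq q ord0.
  by rewrite ltW // node_lt // lt0n.
have node_le1 j q : gl_node xi N a b j q <= cell_left N a b j.+1.
  rewrite -node1; have [->//|q0] := eqVneq q ord_max.
  by rewrite ltW // node_lt // ltn_neqAle -ltnS ltn_ord andbT.
have cl_le j j' : (cell_left N a b j <= cell_left N a b j') = (j <= j')%N.
  by rewrite lerD2l ler_pM2r // ler_nat.
have loc (j : 'I_N) q : (nodal_basis_on xi a b j al).[gl_node xi N a b j q]
    = (dof j q == al)%:R.
  rewrite /nodal_basis_on horner_sum.
  have lag p' : (cell_lagrange xi N a b j p').[gl_node xi N a b j q] = (p' == q)%:R.
    rewrite /cell_lagrange horner_prod; have [->|ne] := eqVneq p' q.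
      rewrite big1 // => r rq; rewrite !hornerE mulVf // subr_eq0.
      by rewrite (inj_eq (@node_inj j)) eq_sym.
    by rewrite (bigD1 q) 1?eq_sym //= !hornerE subrr mulr0 mul0r.
  under eq_bigr do rewrite lag.
  rewrite big_mkcond (bigD1 q) //= eqxx big1 ?addr0; first by case: ifP.
  by move=> r /negPf->; case: ifP.
rewrite /nodal_basis; case: pickP => [j /andP[h1 h2]|/(_ i)]; last first.
  by rewrite node_le0 node_le1.
suff [q [-> <-]] : exists q,
    gl_node xi N a b i p = gl_node xi N a b j q /\ dof j q = dof i p.
  exact: loc.
case: (ltngtP i j) => [ij|ji|/val_inj<-]; last by exists p.
- have E : j = i.+1 :> nat.
    apply/eqP; rewrite eqn_leq ij andbT -cl_le.
    exact: le_trans h1 (node_le1 _ _).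
  have hp : gl_node xi N a b i p = cell_left N a b i.+1.
    by apply/le_anti; rewrite node_le1 -E h1.
  have -> : p = ord_max by apply: (node_inj i); rewrite hp node1.
  exists ord0; rewrite node1 node0 E; split => //.
  by apply/val_inj; rewrite /= !dofK E addn0 mulSnr.
- have E : i = j.+1 :> nat.
    apply/eqP; rewrite eqn_leq ji andbT -cl_le.
    exact: le_trans (node_le0 _ _) h2.
  have hp : gl_node xi N a b i p = cell_left N a b i.
    by apply/le_anti; rewrite node_le0 {2}E h2.
  have -> : p = ord0 by apply: (node_inj i); rewrite hp node0.
  exists ord_max; rewrite node1 node0 E; split => //.
  by apply/val_inj; rewrite /= !dofK E addn0 mulSnr.
Qed.
End Grid1DTheory.

(* (A ⊗ B) q *)
Definition tensor_app (R : realType) (m n : nat) (A : 'M[R]_m) (B : 'M[R]_n)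
    (q : 'M[R]_(m, n)) : 'M[R]_(m, n) :=
  \matrix_(al, be) \sum_al' \sum_be' A al al' * B be be' * q al' be'.

Definition ddx (R : realType) (F : R -> R -> R) (x y : R) : R :=
  derive1 (fun x' => F x' y) x.
Definition ddy (R : realType) (F : R -> R -> R) (x y : R) : R :=
  derive1 (F x) y.

Section Grid2D.
Variables (R : realType) (K : nat) (xi : 'I_K.+1 -> R).
Variables (Nx Ny : nat) (x0 xe y0 ye : R).

Let array := 'M[R]_((Nx * K).+1, (Ny * K).+1).

(* The element of V_h with nodal values q.  The integrals below of its partial
   derivatives run over parts of a single cell, so the values of derive1 at the
   cell interfaces, where q_h has kinks, do not contribute. *)
Definition interp2 (q : array) (x y : R) : R :=
  \sum_al \sum_be
    q al be * (nodal_basis xi x0 xe al x * nodal_basis xi y0 ye be y).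

Definition source_u (c f : R -> R -> R) (tau : R -> R -> R * R)
    (u v : array) : array :=
  \matrix_(al, be)
    let x := dof_coord xi x0 xe al in let y := dof_coord xi y0 ye be in
    c x y * v al be - f x y * u al be + (tau x y).1.

Definition source_v (c f : R -> R -> R) (tau : R -> R -> R * R)
    (u v : array) : array :=
  \matrix_(al, be)
    let x := dof_coord xi x0 xe al in let y := dof_coord xi y0 ye be in
    - (c x y * u al be) - f x y * v al be + (tau x y).2.

(* S_p may depend on (x, y) and on the values of (u, v, p). *)
Definition source_p (sp : R -> R -> R -> R -> R -> R)
    (u v p : array) : array :=
  \matrix_(al, be)
    sp (dof_coord xi x0 xe al) (dof_coord xi y0 ye be)
       (u al be) (v al be) (p al be).

Definition residual_u (p Su : array) (i : 'I_Nx) (s : 'I_K.+1)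
    (j : 'I_Ny) (t : 'I_K.+1) : R :=
  \int[lebesgue_measure]_(x in
      `[gl_node xi Nx x0 xe i ord0, gl_node xi Nx x0 xe i s])
    (ddx (interp2 p) x (gl_node xi Ny y0 ye j t)
     - interp2 Su x (gl_node xi Ny y0 ye j t)).

Definition residual_v (p Sv : array) (i : 'I_Nx) (s : 'I_K.+1)
    (j : 'I_Ny) (t : 'I_K.+1) : R :=
  \int[lebesgue_measure]_(y in
      `[gl_node xi Ny y0 ye j ord0, gl_node xi Ny y0 ye j t])
    (ddy (interp2 p) (gl_node xi Nx x0 xe i s) y
     - interp2 Sv (gl_node xi Nx x0 xe i s) y).

Definition residual_p (u v Sp : array) (i : 'I_Nx) (s : 'I_K.+1)
    (j : 'I_Ny) (t : 'I_K.+1) : R :=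
  \int[lebesgue_measure]_(x in
      `[gl_node xi Nx x0 xe i ord0, gl_node xi Nx x0 xe i s])
    \int[lebesgue_measure]_(y in
        `[gl_node xi Ny y0 ye j ord0, gl_node xi Ny y0 ye j t])
      (ddx (interp2 u) x y + ddy (interp2 v) x y - interp2 Sp x y).

End Grid2D.

(* Main.v *)
Require Import Defs.
From HB Require Import structures.
From mathcomp Require Import all_boot all_order all_algebra ring.
From mathcomp Require Import all_classical all_reals all_analysis.
Set Implicit Arguments.
Unset Strict Implicit.
Unset Printing Implicit Defensive.
Import Order.TTheory GRing.Theory Num.Theory.
Import numFieldNormedType.Exports.
Local Open Scope ring_scope.

(** Call cell increment of a 1D array q the numbers q_{i,s} - q_{i,0}, and write
    d_{i,s} q for them.

    On one cell every element of V_h is a polynomial, so each integral in a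
    residual can be computed exactly there.  Two identities carry the proof: the
    integral over [x_{i,0}, x_{i,s}] of the derivative of the interpolant of q
    is d_{i,s} q, by the fundamental theorem of calculus and because nodal
    values are point values ([poly_int_cell_deriv]); the integral of the
    interpolant itself is d_{i,s} (I_x q), by the very definition of I_x
    ([poly_int_cell]).  Hence the sub-cell residuals are exactly cell increments
    of the arrays to which the scheme applies its derivative matrices:
    - [residual_uE]: the residual of the first equation is d_{i,s}, along the
      grid line y = y_{j,t}, of p - I_x S_u;
    - [residual_pE]: the residual of the third equation is the mixed second
      increment, d_{i,s} in x and d_{j,t} in y, of
      Z = I_y u + I_x v - I_x I_y S_p.
    The second equation is the first one with x and y exchanged.

    On the other side, an array without cell increments interpolates to a
    constant on each cell, so that D_x annihilates it ([deriv_mx_eq0]).  This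
    settles the first two equations.  For the third, vanishing mixed increments
    say that the y-increments of Z, as arrays in x, are annihilated by D_x; so
    D_x Z has no cell increments in y, and D_y annihilates it. *)

(** * Integrals of polynomials *)

Section PolynomialIntegral.
Variable R : realType.
Implicit Types (a b : R) (p q : {poly R}).

Definition poly_int a b p : R := \int[lebesgue_measure]_(x in `[a, b]%classic) p.[x].

Lemma integrable_horner a b p :
  lebesgue_measure.-integrable `[a, b]%classic (EFin \o horner p).
Proof.
apply: continuous_compact_integrable; first exact: segment_compact.
by apply: continuous_subspaceT; exact: continuous_horner.
Qed.

Lemma poly_intD a b p q : poly_int a b (p + q) = poly_int a b p + poly_int a b q.
Proof.
rewrite /poly_int -RintegralD//; [|exact: integrable_horner..].
by apply: eq_Rintegral => x _; rewrite hornerD.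
Qed.

Lemma poly_intZ a b c p : poly_int a b (c *: p) = c * poly_int a b p.
Proof.
rewrite /poly_int -RintegralZl//; last exact: integrable_horner.
by apply: eq_Rintegral => x _; rewrite hornerZ.
Qed.

Lemma poly_intB a b p q : poly_int a b (p - q) = poly_int a b p - poly_int a b q.
Proof. by rewrite -scaleN1r poly_intD poly_intZ mulN1r. Qed.

Lemma poly_int_sum a b (I : finType) (F : I -> {poly R}) :
  poly_int a b (\sum_i F i) = \sum_i poly_int a b (F i).
Proof.
apply: (big_morph (poly_int a b) (poly_intD a b)).
by rewrite -(scale0r (0 : {poly R})) poly_intZ mul0r.
Qed.

Lemma poly_int_deriv a b p : a <= b -> poly_int a b p^`() = p.[b] - p.[a].
Proof.
rewrite le_eqVlt => /predU1P[->|ab].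
  by rewrite /poly_int set_itv1 Rintegral_set1 subrr.
rewrite /poly_int /Rintegral (@continuous_FTC2 _ (horner p^`()) (horner p))//.
- by apply: continuous_subspaceT; exact: continuous_horner.
- split => [x _||]; first exact: derivable_horner.
  + by apply: cvg_at_right_filter; exact: continuous_horner.
  + by apply: cvg_at_left_filter; exact: continuous_horner.
- by move=> x _; rewrite -derivE.
Qed.

(** The end points are excluded because a piecewise polynomial function, and a
    fortiori its derivative, agrees with the polynomial of a cell only in the
    interior of that cell. *)
Lemma Rintegral_eq_poly a b (f : R -> R) p :
  (forall x, a < x < b -> f x = p.[x]) ->
  \int[lebesgue_measure]_(x in `[a, b]%classic) f x = poly_int a b p.
Proof.
move=> fp; congr fine; apply: eq_integral_itv_bounded.
- apply: (@eq_measurable_fun _ _ _ _ _ (horner p)) => [x|].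
    by rewrite inE /= => xab; rewrite fp //; move: xab; rewrite in_itv.
  exact: measurable_poly.
- exact: measurable_poly.
- by move=> x; rewrite in_itv; exact: fp.
Qed.

End PolynomialIntegral.

(** * One-dimensional arrays on one cell *)

Section Cells.
Variables (R : realType) (K : nat) (xi : 'I_K.+1 -> R).
Variables (N : nat) (a b : R).
Hypotheses (K0 : (1 <= K)%N) (glxi : gauss_lobatto xi) (ab : a < b).

Local Notation node := (gl_node xi N a b).
Local Notation lag := (cell_lagrange xi N a b).
Local Notation phi := (nodal_basis xi a b).
Local Notation phi_on := (nodal_basis_on xi a b).
Local Notation vec := 'cV[R]_((N * K).+1).

Lemma mesh_size_gt0 (i : 'I_N) : 0 < mesh_size N a b.
Proof. by rewrite divr_gt0 ?subr_gt0 ?ltr0n ?(leq_trans _ (ltn_ord i)). Qed.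

Lemma lt_cell_left (i : 'I_N) j k :
  (cell_left N a b j < cell_left N a b k) = (j < k)%N.
Proof. by rewrite ltrD2l ltr_pM2r ?(mesh_size_gt0 i)// ltr_nat. Qed.

Lemma gl_node_first i : node i ord0 = cell_left N a b i.
Proof. by case: glxi => xi0 _ _ _; rewrite /gl_node xi0 subrr mul0r mulr0 addr0. Qed.

Lemma gl_node_last i : node i ord_max = cell_left N a b i.+1.
Proof.
case: glxi => _ xi1 _ _; rewrite /gl_node xi1 /cell_left -addrA; congr (_ + _).
by rewrite divff ?pnatr_eq0 // mulr1 -natr1 mulrDl mul1r.
Qed.

Lemma lt_gl_node (i : 'I_N) (p q : 'I_K.+1) : (p < q)%N -> node i p < node i q.
Proof.
case: glxi => _ _ xilt _ /xilt lt_.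
by rewrite ltrD2l ltr_pM2l ?(mesh_size_gt0 i)// ltr_pM2r ?invr_gt0 // ltrD2l.
Qed.

Lemma le_gl_node (i : 'I_N) (p q : 'I_K.+1) : (p <= q)%N -> node i p <= node i q.
Proof. by rewrite leq_eqVlt => /predU1P[/val_inj->//|/(lt_gl_node i)/ltW]. Qed.

Lemma gl_node_inj (i : 'I_N) : injective (node i).
Proof.
move=> p q E; apply/val_inj/eqP; case: ltngtP => // /(lt_gl_node i);
by rewrite E ltxx.
Qed.

Lemma horner_cell_lagrange (i : 'I_N) (p q : 'I_K.+1) :
  (lag i p).[node i q] = (p == q)%:R.
Proof.
rewrite /cell_lagrange horner_prod; have [->|ne] := eqVneq p q.
  rewrite big1 // => r rq; rewrite !hornerE mulVf // subr_eq0.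
  by rewrite (inj_eq (@gl_node_inj i)) eq_sym.
by rewrite (bigD1 q) 1?eq_sym //= !hornerE subrr mulr0 mul0r.
Qed.

Lemma size_cell_lagrange (i : nat) (p : 'I_K.+1) : (size (lag i p) <= K.+1)%N.
Proof.
rewrite /cell_lagrange scaler_prod; apply: leq_trans (size_scale_leq _ _) _.
rewrite (eq_bigl (mem (predC1 p)))//= -big_enum size_prod_XsubC.
by rewrite -cardE cardC1 card_ord.
Qed.

(** The difference of the two sides has degree at most K and vanishes at the
    K + 1 nodes of the cell. *)
Lemma sum_cell_lagrange (i : 'I_N) : \sum_(p < K.+1) lag i p = 1.
Proof.
apply/eqP; rewrite -subr_eq0; apply/eqP.
apply: (@roots_geq_poly_eq0 _ _ [seq node i p | p <- enum 'I_K.+1]).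
- apply/allP => _ /mapP[q _ ->]; rewrite /root !hornerE horner_sum (bigD1 q)//=.
  rewrite horner_cell_lagrange eqxx big1 ?addr0 ?subrr// => p /negPf pq.
  by rewrite horner_cell_lagrange pq.
- by rewrite map_inj_uniq ?enum_uniq//; exact: gl_node_inj.
- rewrite size_map size_enum_ord (leq_trans (size_polyD _ _))//.
  rewrite geq_max size_polyN size_poly1 andbT (leq_trans (size_sum _ _ _))//.
  by apply/bigmax_leqP => p _; exact: size_cell_lagrange.
Qed.

Definition cell_poly (i : 'I_N) (q : vec) : {poly R} :=
  \sum_al q al 0 *: phi_on i al.

Lemma cell_polyE (i : 'I_N) (q : vec) :
  cell_poly i q = \sum_(p < K.+1) q (dof i p) 0 *: lag i p.
Proof.
rewrite /cell_poly /nodal_basis_on.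
under eq_bigr do rewrite scaler_sumr big_mkcond.
rewrite exchange_big; apply: eq_bigr => p _ /=.
rewrite (bigD1 (dof i p))//= eqxx big1 ?addr0// => al /negPf.
by rewrite eq_sym => ->.
Qed.

Lemma horner_cell_poly (i : 'I_N) (q : vec) x :
  (cell_poly i q).[x] = \sum_al q al 0 * (phi_on i al).[x].
Proof. by rewrite horner_sum; apply: eq_bigr => al _; rewrite hornerZ. Qed.

Lemma horner_deriv_cell_poly (i : 'I_N) (q : vec) x :
  (cell_poly i q)^`().[x] = \sum_al q al 0 * (phi_on i al)^`().[x].
Proof.
rewrite /cell_poly linear_sum horner_sum.
by apply: eq_bigr => al _; rewrite linearZ /= hornerZ.
Qed.

Lemma cell_poly_node (i : 'I_N) (q : vec) (p : 'I_K.+1) :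
  (cell_poly i q).[node i p] = q (dof i p) 0.
Proof.
rewrite cell_polyE horner_sum (bigD1 p)//= hornerZ horner_cell_lagrange eqxx mulr1.
rewrite big1 ?addr0// => r /negPf rp.
by rewrite hornerZ horner_cell_lagrange rp mulr0.
Qed.

(** An interior point of a cell lies in no other closed cell, so that the cell
    picked in the definition of the basis function is the expected one. *)
Lemma nodal_basis_interior (i : 'I_N) al x :
  node i ord0 < x < node i ord_max -> phi al x = (phi_on i al).[x].
Proof.
rewrite gl_node_first gl_node_last => /andP[ix xi_].
rewrite /nodal_basis; case: pickP => [j /andP[jx xj]|/(_ i)]; last by rewrite !ltW.
suff -> : j = i by [].
apply/val_inj/eqP; rewrite eqn_leq -(ltnS j) -(ltnS i) -2!(lt_cell_left i).
by rewrite (le_lt_trans jx xi_) (lt_le_trans ix xj).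
Qed.

Lemma interp1_interior (i : 'I_N) (q : vec) x :
  node i ord0 < x < node i ord_max -> interp1 xi a b q x = (cell_poly i q).[x].
Proof.
move=> hx; rewrite horner_cell_poly; apply: eq_bigr => al _.
by rewrite (nodal_basis_interior _ hx).
Qed.

Lemma derive1_interp1_interior (i : 'I_N) (q : vec) x :
  node i ord0 < x < node i ord_max ->
  derive1 (interp1 xi a b q) x = (cell_poly i q)^`().[x].
Proof.
move=> hx; rewrite derivE !derive1E; apply: near_eq_derive.
have : x \in `](node i ord0), (node i ord_max)[ by rewrite in_itv.
move/near_in_itvoo; apply: filterS => z.
by rewrite in_itv /= => /interp1_interior.
Qed.

Definition cell_incr (i : 'I_N) (s : 'I_K.+1) (q : vec) : R :=
  q (dof i s) 0 - q (dof i ord0) 0.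

Lemma cell_interior_sub (i : 'I_N) (s : 'I_K.+1) x :
  node i ord0 < x < node i s -> node i ord0 < x < node i ord_max.
Proof.
by move=> /andP[-> xs]; rewrite (lt_le_trans xs)// le_gl_node// -ltnS ltn_ord.
Qed.

Lemma poly_int_cell_deriv (i : 'I_N) (s : 'I_K.+1) (q : vec) :
  poly_int (node i ord0) (node i s) (cell_poly i q)^`() = cell_incr i s q.
Proof. by rewrite poly_int_deriv ?le_gl_node// !cell_poly_node. Qed.

(** By linearity it suffices to treat a basis array, for which the right-hand
    side is the defining relation of the integration operator. *)
Lemma poly_int_cell (i : 'I_N) (s : 'I_K.+1) (q : vec) :
  poly_int (node i ord0) (node i s) (cell_poly i q) =
  cell_incr i s (int_mx xi N a b *m q).
Proof.
rewrite /cell_incr !mxE -sumrB /cell_poly poly_int_sum.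
apply: eq_bigr => al _; rewrite poly_intZ -mulrBl mulrC !mxE; congr (_ * _).
have [_ /(_ i s)] := int_op_spec xi a b (delta_mx al 0) K0.
rewrite !mxE => ->; rewrite [RHS]addrAC subrr add0r; symmetry.
rewrite /int_from_left (Rintegral_eq_poly (p := phi_on i al))//.
move=> x /cell_interior_sub hx.
rewrite (interp1_interior _ hx) horner_cell_poly (bigD1 al)//= big1 ?addr0.
  by rewrite mxE !eqxx mul1r.
by move=> be /negPf ne; rewrite mxE ne mul0r.
Qed.

(** Row by row, the product is a combination of values of the derivative of the
    interpolant on the cells, and the interpolant is constant on each cell since
    the Lagrange polynomials of a cell sum to 1. *)
Lemma deriv_mx_eq0 m (W : 'M[R]_((N * K).+1, m)) :
  (forall (i : 'I_N) (s : 'I_K.+1) be, cell_incr i s (col be W) = 0) ->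
  deriv_mx xi N a b *m W = 0.
Proof.
move=> W0; apply/matrixP => al be; rewrite !mxE.
under eq_bigr do rewrite mxE mulr_suml.
rewrite exchange_big big1//= => i _.
under eq_bigr do rewrite mulr_suml.
rewrite exchange_big big1//= => p _.
under eq_bigr do rewrite -!mulrA.
rewrite -!mulr_sumr.
suff -> : \sum_al' (phi_on i al')^`().[node i p] * W al' be = 0 by rewrite !mulr0.
transitivity ((cell_poly i (col be W))^`().[node i p]).
  rewrite horner_deriv_cell_poly; apply: eq_bigr => al' _.
  by rewrite mxE mulrC.
rewrite cell_polyE (eq_bigr (fun s => W (dof i ord0) be *: lag i s)).
  by rewrite -scaler_sumr sum_cell_lagrange linearZ/= derivC scaler0 horner0.
by move=> s _; have /eqP := W0 i s be; rewrite subr_eq0 !mxE => /eqP->.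
Qed.

Lemma dof_surj (al : 'I_(N * K).+1) : (0 < N)%N -> exists i p, al = dof (i : 'I_N) p.
Proof.
move=> N0; have [alN|] := ltnP al (N * K).
  have h : (al %/ K < N)%N by rewrite ltn_divLR.
  exists (Ordinal h), (inord (al %% K)); apply/val_inj.
  by rewrite /= dofK /= inordK -?divn_eq// ltnW// ltnS ltn_pmod.
(* The last unknown opens no cell: it is the right end of the last one. *)
move=> alN; have h : (N.-1 < N)%N by rewrite prednK.
exists (Ordinal h), ord_max; apply/val_inj/eqP.
by rewrite /= dofK /= -mulSnr prednK// eqn_leq alN -ltnS ltn_ord.
Qed.

End Cells.

(** * Two-dimensional arrays and their slices *)

Lemma col_mulmx (R : pzSemiRingType) m n r (A : 'M[R]_(m, n)) (B : 'M[R]_(n, r)) j :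
  col j (A *m B) = A *m col j B.
Proof. by apply/matrixP => i k; rewrite !mxE; apply: eq_bigr => l _; rewrite mxE. Qed.

Section Slices.
Variables (R : realType) (K : nat) (xi : 'I_K.+1 -> R).

Lemma tensor_appE m n (A : 'M[R]_m) (B : 'M[R]_n) (q : 'M[R]_(m, n)) :
  tensor_app A B q = A *m q *m B^T.
Proof.
apply/matrixP => al be; rewrite !mxE exchange_big; apply: eq_bigr => be' _ /=.
by rewrite !mxE mulr_suml; apply: eq_bigr => al' _; rewrite mulrAC.
Qed.

Lemma tensor_app_tr m n (A : 'M[R]_m) (B : 'M[R]_n) (q : 'M[R]_(m, n)) :
  tensor_app A B q = (tensor_app B A q^T)^T.
Proof. by rewrite !tensor_appE !trmx_mul !trmxK mulmxA. Qed.

Variables (Nx Ny : nat) (x0 xe y0 ye : R).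

Local Notation arr := 'M[R]_((Nx * K).+1, (Ny * K).+1).

Lemma interp2_tr (q : arr) x y :
  interp2 xi x0 xe y0 ye q x y = interp2 xi y0 ye x0 xe q^T y x.
Proof.
rewrite /interp2 exchange_big; apply: eq_bigr => be _; apply: eq_bigr => al _ /=.
by rewrite mxE [_ * nodal_basis _ _ _ be _]mulrC.
Qed.

Lemma ddy_interp2_tr (q : arr) x y :
  ddy (interp2 xi x0 xe y0 ye q) x y = ddx (interp2 xi y0 ye x0 xe q^T) y x.
Proof.
by rewrite /ddx /ddy; congr derive1; apply/funext => z; exact: interp2_tr.
Qed.

Lemma residual_v_tr (p S : arr) (i : 'I_Nx) s (j : 'I_Ny) t :
  residual_v xi x0 xe y0 ye p S i s j t =
  residual_u xi y0 ye x0 xe p^T S^T j t i s.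
Proof.
by apply: eq_Rintegral => y _; rewrite ddy_interp2_tr interp2_tr.
Qed.

(** Brings partial derivatives and integrals in x, at fixed y, back to 1D arrays. *)
Lemma interp2_interp1 (q : arr) x y :
  interp2 xi x0 xe y0 ye q x y =
  interp1 xi x0 xe (q *m \col_be nodal_basis xi y0 ye be y) x.
Proof.
apply: eq_bigr => al _; rewrite mxE mulr_suml; apply: eq_bigr => be _.
by rewrite mxE mulrA mulrAC.
Qed.

Hypotheses (glxi : gauss_lobatto xi) (x0e : x0 < xe).

Lemma ddx_interp2 (q : arr) (i : 'I_Nx) x y :
  gl_node xi Nx x0 xe i ord0 < x < gl_node xi Nx x0 xe i ord_max ->
  ddx (interp2 xi x0 xe y0 ye q) x y =
  (cell_poly xi x0 xe i (q *m \col_be nodal_basis xi y0 ye be y))^`().[x].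
Proof.
move=> hx; rewrite -derive1_interp1_interior// /ddx; congr derive1.
by apply/funext => x'; rewrite interp2_interp1.
Qed.

End Slices.

(** * Residuals as cell increments *)

Section Residuals.
Variables (R : realType) (K : nat) (xi : 'I_K.+1 -> R).
Variables (Nx Ny : nat) (x0 xe y0 ye : R).
Hypotheses (K0 : (1 <= K)%N) (glxi : gauss_lobatto xi).
Hypotheses (x0e : x0 < xe) (y0e : y0 < ye).

Local Notation arr := 'M[R]_((Nx * K).+1, (Ny * K).+1).
Local Notation xnode := (gl_node xi Nx x0 xe).
Local Notation ynode := (gl_node xi Ny y0 ye).
Local Notation Ix := (int_mx xi Nx x0 xe).
Local Notation Iy := (int_mx xi Ny y0 ye).

Lemma residual_uE (p S : arr) (i : 'I_Nx) s (j : 'I_Ny) t :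
  residual_u xi x0 xe y0 ye p S i s j t =
  cell_incr i s (col (dof j t) (p - Ix *m S)).
Proof.
have colN (q : arr) :
    q *m (\col_be nodal_basis xi y0 ye be (ynode j t)) = col (dof j t) q.
  rewrite colE; congr (_ *m _); apply/matrixP => be k.
  by rewrite !mxE nodal_basis_node// ord1 eqxx andbT eq_sym.
rewrite /residual_u (Rintegral_eq_poly (p :=
    (cell_poly xi x0 xe i (col (dof j t) p))^`()
    - cell_poly xi x0 xe i (col (dof j t) S))).
  rewrite poly_intB poly_int_cell_deriv// poly_int_cell//.
  by rewrite /cell_incr -col_mulmx !mxE; ring.
move=> x /(cell_interior_sub glxi x0e) hx.
rewrite hornerD hornerN (ddx_interp2 _ _ glxi x0e _ _ hx) interp2_interp1.
by rewrite (interp1_interior glxi x0e _ hx) !colN.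
Qed.

Definition col_incr (j : 'I_Ny) (t : 'I_K.+1) (Z : arr) :=
  col (dof j t) Z - col (dof j ord0) Z.

(** Increments in y commute with the evaluation in x.  The rows of A are indexed
    by y here, whence the transpose. *)
Lemma cell_incr_mul_basis (j : 'I_Ny) t (A : 'M[R]_((Ny * K).+1, (Nx * K).+1))
    (i : 'I_Nx) x :
  cell_incr j t (A *m \col_al (nodal_basis_on xi x0 xe i al).[x]) =
  (cell_poly xi x0 xe i (col_incr j t A^T)).[x].
Proof.
rewrite /cell_incr horner_cell_poly !mxE -sumrB; apply: eq_bigr => al _.
by rewrite !mxE mulrBl.
Qed.

Lemma cell_incr_mul_deriv_basis (j : 'I_Ny) t
    (A : 'M[R]_((Ny * K).+1, (Nx * K).+1)) (i : 'I_Nx) x :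
  cell_incr j t (A *m \col_al (nodal_basis_on xi x0 xe i al)^`().[x]) =
  (cell_poly xi x0 xe i (col_incr j t A^T))^`().[x].
Proof.
rewrite /cell_incr horner_deriv_cell_poly !mxE -sumrB; apply: eq_bigr => al _.
by rewrite !mxE mulrBl.
Qed.

(** For fixed x in the interior of a cell, the integrand is a polynomial in y
    whose nodal values are 1D interpolants evaluated at x; so integrating in y
    replaces each array by its y-increments, and leaves a polynomial in x ready
    for the outer integral. *)
Lemma inner_residual_p (u v S : arr) (i : 'I_Nx) (j : 'I_Ny) t x :
  xnode i ord0 < x < xnode i ord_max ->
  \int[lebesgue_measure]_(y in `[ynode j ord0, ynode j t]%classic)
     (ddx (interp2 xi x0 xe y0 ye u) x y + ddy (interp2 xi x0 xe y0 ye v) x y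
      - interp2 xi x0 xe y0 ye S x y) =
  ((cell_poly xi x0 xe i (col_incr j t (u *m Iy^T)))^`()
   + cell_poly xi x0 xe i (col_incr j t v)
   - cell_poly xi x0 xe i (col_incr j t (S *m Iy^T))).[x].
Proof.
move=> hx.
pose f := \col_al (nodal_basis_on xi x0 xe i al).[x].
pose f' := \col_al (nodal_basis_on xi x0 xe i al)^`().[x].
have fE : \col_al nodal_basis xi x0 xe al x = f.
  by apply/matrixP => al k; rewrite !mxE; exact: nodal_basis_interior hx.
rewrite (Rintegral_eq_poly (p := cell_poly xi y0 ye j (u^T *m f')
   + (cell_poly xi y0 ye j (v^T *m f))^`() - cell_poly xi y0 ye j (S^T *m f))).
  rewrite poly_intB poly_intD poly_int_cell_deriv// !poly_int_cell// !mulmxA.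
  by rewrite cell_incr_mul_deriv_basis !cell_incr_mul_basis !trmx_mul !trmxK !hornerE.
move=> y /(cell_interior_sub glxi y0e) hy.
rewrite ddy_interp2_tr interp2_tr (ddx_interp2 _ _ glxi y0e _ _ hy)
  (ddx_interp2 _ _ glxi x0e _ _ hx).
rewrite interp2_interp1 fE (interp1_interior glxi y0e _ hy) !hornerE.
congr (_ + _ - _).
rewrite horner_deriv_cell_poly horner_cell_poly.
under eq_bigr do rewrite mxE mulr_suml.
rewrite exchange_big; apply: eq_bigr => be _ /=.
rewrite [in RHS]mxE mulr_suml; apply: eq_bigr => al _.
by rewrite !mxE (nodal_basis_interior glxi y0e _ hy) mulrAC.
Qed.

Lemma residual_pE (u v S : arr) (i : 'I_Nx) s (j : 'I_Ny) t :
  residual_p xi x0 xe y0 ye u v S i s j t =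
  cell_incr i s (col_incr j t (u *m Iy^T + Ix *m v - Ix *m S *m Iy^T)).
Proof.
rewrite /residual_p.
rewrite (Rintegral_eq_poly (p :=
    (cell_poly xi x0 xe i (col_incr j t (u *m Iy^T)))^`()
   + cell_poly xi x0 xe i (col_incr j t v)
   - cell_poly xi x0 xe i (col_incr j t (S *m Iy^T)))); last first.
  by move=> x /(cell_interior_sub glxi x0e) hx; rewrite (inner_residual_p _ _ _ _ _ hx).
rewrite poly_intB poly_intD poly_int_cell_deriv// !poly_int_cell//.
rewrite /col_incr !mulmxBr -!col_mulmx mulmxA /cell_incr.
by rewrite !mxE; ring.
Qed.

(** * Vanishing residuals annihilate the spatial part *)

Lemma gf_u_eq0 (p S : arr) : (0 < Ny)%N ->
  (forall i s j t, residual_u xi x0 xe y0 ye p S i s j t = 0) ->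
  deriv_mx xi Nx x0 xe *m (p - Ix *m S) = 0.
Proof.
move=> Ny0 h; apply: deriv_mx_eq0 => // i s be.
by have [j [t ->]] := dof_surj K0 be Ny0; rewrite -residual_uE.
Qed.

(** The argument for the first equation is used twice: in x for the y-increments
    of the array, then in y for the rows of its image by the x-derivative
    matrix. *)
Lemma gf_p_eq0 (u v S : arr) :
  (forall i s j t, residual_p xi x0 xe y0 ye u v S i s j t = 0) ->
  deriv_mx xi Nx x0 xe *m (u *m Iy^T + Ix *m v - Ix *m S *m Iy^T)
    *m (deriv_mx xi Ny y0 ye)^T = 0.
Proof.
move=> h; set Z := (X in _ *m X *m _); set Dx := deriv_mx xi Nx x0 xe.
apply: trmx_inj; rewrite trmx_mul trmxK trmx0.
apply: deriv_mx_eq0 => // j t al.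
have : Dx *m col_incr j t Z = 0.
  apply: deriv_mx_eq0 => // i s k.
  by rewrite ord1 col_id -residual_pE.
rewrite /col_incr mulmxBr -!col_mulmx => /matrixP/(_ al 0).
by rewrite /cell_incr !mxE.
Qed.

End Residuals.

Theorem proposition6 (R : realType) (K : nat) (xi : 'I_K.+1 -> R)
    (Nx Ny : nat) (x0 xe y0 ye : R)
    (c f : R -> R -> R) (tau : R -> R -> R * R)
    (sp : R -> R -> R -> R -> R -> R)
    (u v p : 'M[R]_((Nx * K).+1, (Ny * K).+1)) :
  (1 <= K)%N -> gauss_lobatto xi ->
  (0 < Nx)%N -> (0 < Ny)%N -> x0 < xe -> y0 < ye ->
  let Mx := mass_mx xi Nx x0 xe in let My := mass_mx xi Ny y0 ye in
  let Dx := deriv_mx xi Nx x0 xe in let Dy := deriv_mx xi Ny y0 ye in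
  let Ix := int_mx xi Nx x0 xe in let Iy := int_mx xi Ny y0 ye in
  let Su := source_u xi x0 xe y0 ye c f tau u v in
  let Sv := source_v xi x0 xe y0 ye c f tau u v in
  let Sp := source_p xi x0 xe y0 ye sp u v p in
  (forall (i : 'I_Nx) (j : 'I_Ny) (s t : 'I_K.+1),
     [/\ residual_u xi x0 xe y0 ye p Su i s j t = 0,
         residual_v xi x0 xe y0 ye p Sv i s j t = 0
       & residual_p xi x0 xe y0 ye u v Sp i s j t = 0]) ->
  [/\ tensor_app Dx My (p - tensor_app Ix 1%:M Su) = 0,
      tensor_app Mx Dy (p - tensor_app 1%:M Iy Sv) = 0
    & tensor_app Dx Dy (tensor_app 1%:M Iy u + tensor_app Ix 1%:M v
                        - tensor_app Ix Iy Sp) = 0].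
Proof.
move=> K0 glxi Nx0 Ny0 x0e y0e Mx My Dx Dy Ix Iy Su Sv Sp res0; split.
- rewrite !tensor_appE trmx1 mulmx1 (gf_u_eq0 K0 glxi x0e y0e) ?mul0mx// => i s j t.
  by have [] := res0 i j s t.
- rewrite tensor_app_tr [tensor_app 1%:M _ _]tensor_app_tr linearB/= trmxK.
  rewrite !tensor_appE trmx1 mulmx1 (gf_u_eq0 K0 glxi y0e x0e) ?mul0mx ?trmx0//.
  by move=> j t i s; have [_ + _] := res0 i j s t; rewrite residual_v_tr.
- rewrite !tensor_appE trmx1 mulmx1 mul1mx gf_p_eq0// => i s j t.
  by have [] := res0 i j s t.
Qed.
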